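(* For every complex number $q$ with $|q|<1$, $$\Psi(q^{22},q^{10})+q\,\Psi(q^{26},q^6)=\sum_{n=0}^\infty \frac{(-1)^nq^{n(n+3)/2}(q;q)_n(-q;q^2)_n}{(q;q)_{2n+1}}.$$
   Context: Notation: $(a;q)_n=\prod_{j=0}^{n-1}(1-aq^j)$ (so $(a;q)_0=1$); the base may be replaced by a power of $q$. The false theta series is $$\Psi(a,b)=\sum_{n=0}^\infty a^{n(n+1)/2}b^{n(n-1)/2}-\sum_{n=1}^\infty a^{n(n-1)/2}b^{n(n+1)/2}$$ for $|ab|<1$ (with $0^0=1$). *)

(* Defs.v *)
From mathcomp Require Import all_boot all_order all_algebra.
From mathcomp Require Import complex.
From mathcomp Require Import all_classical all_reals all_analysis.

Set Implicit Arguments.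
Unset Strict Implicit.
Unset Printing Implicit Defensive.

Import Order.TTheory GRing.Theory Num.Theory.
Import numFieldNormedType.Exports.

Local Open Scope ring_scope.

(* R[i], packaged so that it inherits the norm topology that the library puts
   on the carrier of any numClosedFieldType (the bare type R[i] does not). *)
Definition Cplx (R : realType) : numClosedFieldType := R[i].

(* The library has this notation only for extended reals; as there, the sum
   is the limit of the partial sums. *)
Notation "\sum_ ( m <= i '<oo' ) F" :=
  (\big[+%R/0%R]_(m <= i <oo) F%R) : ring_scope.

(* (a; q)_n *)
Definition qpoch (K : fieldType) (a q : K) (n : nat) : K :=
  \prod_(0 <= j < n) (1 - a * q ^+ j).

(* All halved exponents are even. The truncation in n.-1 is harmless: at n = 0
   the exponent n * n.-1 is 0. *)
Definition Psi (R : realType) (a b : Cplx R) : Cplx R :=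
  \sum_(0 <= n <oo) (a ^+ (n * n.+1)./2 * b ^+ (n * n.-1)./2)
  - \sum_(1 <= n <oo) (a ^+ (n * n.-1)./2 * b ^+ (n * n.+1)./2).

(* Main.v *)
Require Import Defs.
From mathcomp Require Import all_boot all_order all_algebra.
From mathcomp Require Import ring lra zify.
From mathcomp Require Import complex.
From mathcomp Require Import all_classical all_reals all_analysis.

Import Order.TTheory GRing.Theory Num.Theory.
Import numFieldNormedType.Exports.

Local Open Scope classical_set_scope.
Local Open Scope ring_scope.

(** Write (q)_n for (q;q)_n. Interleaving the four one-sided series in the two
false theta functions according to the parity of r turns the left-hand side
into one series,
  sum_(r >= 0) (-1)^r q^(4r^2 + 3r) (1 + q^(2r+1))        (lemma [Psi_theta]),
and the identity is then an instance of the Bailey transform. The Bailey pair,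
relative to a = q^2 and supported on the even indices, is
  (-q;q^2)_n / (q)_(2n+1)
    = sum_r (-1)^r q^(2r^2) (1 - q^(4r+2)) / ((q)_(n-2r) (q)_(n+2r+2))
([bailey_pair]); it is a special case of the very-well-poised 6phi5 sum and has
a telescoping proof. Inserting it in the series on the right and exchanging the
sums leaves, for each m = 2r, a sum over n that is evaluated by a q-analogue of
the Vandermonde convolution ([qVandermonde], [conjugate_bailey_pair]).

To avoid exchanging infinite sums, the n-th term is first multiplied by the
weight (q)_N / (q)_(N-n), for which the sum over n is finite and still
summable in closed form. For N = 2s this is an identity between two finite
sums ([truncated_identity]): the terms of both series appear with weights that
tend to 1 as N grows. With x = |q|, a weight of index k differs from 1 by
O(x^(N-k)) (here k = n, respectively k = 2r), while the term it multiplies is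
O(x^(2n)), respectively O(x^(3r)). Removing the weights therefore changes each
side by O(x^N) only ([qhyp_weight_bound], [theta_weight_bound]), so the two
series have the same sum. *)

(** * q-shifted factorials and the q-Vandermonde sum *)

Lemma qpoch0 (K : fieldType) (a q : K) : qpoch a q 0 = 1.
Proof. by rewrite /qpoch big_nil. Qed.

Lemma qpochS (K : fieldType) (a q : K) (n : nat) :
  qpoch a q n.+1 = qpoch a q n * (1 - a * q ^+ n).
Proof. by rewrite /qpoch big_nat_recr. Qed.

Lemma qpochD (K : fieldType) (a q : K) (m n : nat) :
  qpoch a q (m + n) = qpoch a q m * qpoch (a * q ^+ m) q n.
Proof.
elim: n => [|n IH]; first by rewrite addn0 qpoch0 mulr1.
by rewrite addnS !qpochS IH -mulrA -[a * _ * _]mulrA -exprD.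
Qed.

Lemma qpoch_recl (K : fieldType) (a q : K) (n : nat) :
  qpoch a q n.+1 = (1 - a) * qpoch (a * q) q n.
Proof. by rewrite -add1n qpochD qpochS qpoch0 mul1r expr0 mulr1 expr1. Qed.

Lemma qpoch_neq0 (K : fieldType) (a q : K) (n : nat) :
  (forall j, 1 - a * q ^+ j != 0) -> qpoch a q n != 0.
Proof.
move=> h; elim: n => [|n IH]; first by rewrite qpoch0 oner_neq0.
by rewrite qpochS mulf_neq0.
Qed.

(** Gaussian binomial coefficients, defined by the q-Pascal rule so that they
make sense for every q. When k exceeds n the truncated exponent n' - k' is
multiplied by a vanishing coefficient. *)
Fixpoint qbin (K : fieldType) (q : K) (n k : nat) : K :=
  match n, k with
  | _, 0%N => 1
  | 0%N, _.+1 => 0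
  | n'.+1, k'.+1 => qbin K q n' k'.+1 + q ^+ (n' - k') * qbin K q n' k'
  end.
Arguments qbin {K} q n k.

Lemma qbin0 (K : fieldType) (q : K) (n : nat) : qbin q n 0 = 1.
Proof. by case: n. Qed.

Lemma qbinS (K : fieldType) (q : K) (n k : nat) :
  qbin q n.+1 k.+1 = qbin q n k.+1 + q ^+ (n - k) * qbin q n k.
Proof. by []. Qed.

Lemma qbin_small (K : fieldType) (q : K) (n k : nat) :
  (n < k)%N -> qbin q n k = 0.
Proof.
elim: n k => [|n IH] [|k] // nk.
by rewrite qbinS !IH ?mulr0 ?addr0 //; apply: leqW.
Qed.

(** Division-free form of the quotient formula for Gaussian binomials; writing
the upper index as n + k avoids truncated subtraction. *)
Lemma qbin_qpoch (K : fieldType) (q : K) (n k : nat) :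
  qbin q (n + k) k * qpoch q q k * qpoch q q n = qpoch q q (n + k).
Proof.
move: {2}(n + k)%N (erefl (n + k)%N) => s.
elim: s n k => [|s IH] n k.
  by move/eqP; rewrite addn_eq0 => /andP[/eqP-> /eqP->]; rewrite qbin0 qpoch0 !mulr1.
case: k => [|k] E; first by rewrite addn0 qbin0 qpoch0 mulr1 mul1r.
case: n E => [|n] E.
  rewrite add0n qbinS qbin_small // add0r subnn mul1r qpoch0 mulr1.
  have := IH 0%N k; rewrite add0n qpoch0 mulr1 qpochS mulrA => -> //.
  by lia.
rewrite addSn addnS qbinS.
have -> : ((n + k).+1 - k = n.+1)%N by lia.
have H1 := IH n k.+1; have H2 := IH n.+1 k.
rewrite addnS in H1; rewrite addSn in H2.
have {}H1 := H1 ltac:(lia); have {}H2 := H2 ltac:(lia).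
have -> : (qbin q (n + k).+1 k.+1 + q ^+ n.+1 * qbin q (n + k).+1 k) *
   qpoch q q k.+1 * qpoch q q n.+1 =
   qbin q (n + k).+1 k.+1 * qpoch q q k.+1 * qpoch q q n * (1 - q * q ^+ n)
   + q ^+ n.+1 * (1 - q * q ^+ k) * (qbin q (n + k).+1 k * qpoch q q k * qpoch q q n.+1).
  by rewrite !(qpochS _ q q); ring.
rewrite H1 H2 [RHS]qpochS !exprS exprD; ring.
Qed.

(** The q-Chu-Vandermonde sum 2phi1(q^-M, a; ab; b q^M). The q-Pascal rule
gives S_(M+1)(a) = S_M(a) - b q^M (1-a)/(1-ab) S_M(aq), and the right-hand side
satisfies the same recurrence. *)
Lemma qVandermonde (K : fieldType) (q a b : K) (M : nat) :
  (forall j, 1 - a * b * q ^+ j != 0) ->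
  \sum_(k < M.+1) (-1) ^+ k * q ^+ 'C(k, 2) * qbin q M k
      * qpoch a q k * b ^+ k / qpoch (a * b) q k
  = qpoch b q M / qpoch (a * b) q M.
Proof.
elim: M a => [|M IH] a h.
  by rewrite big_ord_recl big_ord0 /= !qpoch0 !mulr1 addr0.
have h' : forall j, 1 - a * q * b * q ^+ j != 0.
  by move=> j; have := h j.+1; rewrite exprS; congr (_ != _); ring.
rewrite big_ord_recl.
have step (i : 'I_M.+1) : (-1) ^+ lift ord0 i * q ^+ 'C(lift ord0 i, 2)
    * qbin q M.+1 (lift ord0 i) * qpoch a q (lift ord0 i) * b ^+ lift ord0 i
    / qpoch (a * b) q (lift ord0 i)
  = (-1) ^+ i.+1 * q ^+ 'C(i.+1, 2) * qbin q M i.+1 * qpoch a q i.+1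
      * b ^+ i.+1 / qpoch (a * b) q i.+1
    - b * q ^+ M * (1 - a) / (1 - a * b)
      * ((-1) ^+ i * q ^+ 'C(i, 2) * qbin q M i * qpoch (a * q) q i * b ^+ i
         / qpoch (a * q * b) q i).
  have iM : (i <= M)%N by rewrite -ltnS.
  have eM : q ^+ M = q ^+ (M - i) * q ^+ i by rewrite -exprD subnK.
  rewrite lift0 qbinS eM binS bin1 exprD !(qpoch_recl _ _ _ i).
  rewrite !exprS (_ : a * b * q = a * q * b); last by ring.
  have n1 := qpoch_neq0 K (a * q * b) q i h'.
  have n2 := h 0%N; rewrite expr0 mulr1 in n2.
  by field; rewrite n1 n2.
rewrite (eq_bigr _ (fun i _ => step i)) big_split /= sumrN -mulr_sumr IH // !qpoch0.
rewrite addrA.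
have -> : (-1) ^+ 0 * q ^+ 'C(0, 2) * 1 * 1 * b ^+ 0 / 1 +
  \sum_(i < M.+1) ((-1) ^+ i.+1 * q ^+ 'C(i.+1, 2) * qbin q M i.+1 *
   qpoch a q i.+1 * b ^+ i.+1 / qpoch (a * b) q i.+1)
  = qpoch b q M / qpoch (a * b) q M.
  rewrite -(IH a h) [in RHS]big_ord_recl big_ord_recr /= qbin_small //.
  rewrite mulr0 !mul0r addr0 qbin0 !qpoch0; congr (_ + _).
have n1 := qpoch_neq0 K (a * q * b) q M h'.
have n0 := qpoch_neq0 K (a * b) q M h.
have n2 := h 0%N; rewrite expr0 mulr1 in n2.
have n3 := h M.
have e : qpoch (a * q * b) q M = qpoch (a * b) q M * (1 - a * b * q ^+ M) / (1 - a * b).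
  rewrite -qpochS qpoch_recl (_ : a * b * q = a * q * b); last by ring.
  by field.
rewrite e !qpochS; field.
by rewrite n0 n2 n3.
Qed.

(** * The Bailey pair and the truncated identity *)

Lemma qq_neq0 (K : fieldType) (q : K) (n : nat) :
  (forall j, 1 - q ^+ j.+1 != 0) -> qpoch q q n != 0.
Proof. by move=> hq; apply: qpoch_neq0 => j; rewrite -exprS. Qed.

(** The reciprocal of (q)_(n-j), with its usual value 0 at negative indices. *)
Definition invqq (K : fieldType) (q : K) (n j : nat) : K :=
  if (j <= n)%N then (qpoch q q (n - j))^-1 else 0.
Arguments invqq {K} q n j.

Definition bailey_term (K : fieldType) (q : K) (n r : nat) : K :=
  (-1) ^+ r * q ^+ (2 * r ^ 2) * (1 - q ^+ (4 * r + 2)) * invqq q n (2 * r)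
  / qpoch q q (n + 2 * r + 2).
Arguments bailey_term {K} q n r.

(** The companion, in the sense of Wilf and Zeilberger, of [bailey_term]. It is
found by looking for a Laurent polynomial P(y) in y = q^(2r) for which
(-1)^r q^(2r^2) P(y) / ((q)_(n+1-2r) (q)_(n+2r+1)) telescopes; comparing
coefficients yields P(y) = q^(n+1) (y - 1/y). The factor 1/y is absorbed in the
exponent 2r(r-1), so that q = 0 needs no separate treatment. *)
Definition bailey_cert (K : fieldType) (q : K) (n r : nat) : K :=
  (-1) ^+ r * q ^+ (2 * r * r.-1) * q ^+ n.+1 * (q ^+ (4 * r) - 1)
  * invqq q n.+1 (2 * r) / qpoch q q (n + 2 * r + 1).
Arguments bailey_cert {K} q n r.

Lemma invqqSr (K : fieldType) (q : K) (n j : nat) :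
  (forall j, 1 - q ^+ j.+1 != 0) ->
  invqq q n j.+1 = (1 - q ^+ (n - j)) * invqq q n j.
Proof.
move=> hq; rewrite /invqq; have [lt|gt|->] := ltngtP j n.
- rewrite -(subnSK lt) qpochS -exprS invfM mulrCA mulfV ?hq // mulr1 //.
- by rewrite mulr0.
by rewrite subnn expr0 subrr mul0r.
Qed.

(** The recurrence in n satisfied by (-q;q^2)_n / (q)_(2n+1), up to a
telescoping difference. In terms of y = q^(2r), q^n and w = q^(2r(r-1)) it is a
rational function identity; only the boundary cases 2r = n+1 and 2r > n+1, where
some reciprocals vanish, are treated apart. *)
Lemma bailey_term_telescope (K : fieldType) (q : K) (n r : nat) :
  (forall j, 1 - q ^+ j.+1 != 0) ->
  (1 - q ^+ (2 * n + 2)) * (1 - q ^+ (2 * n + 3)) * bailey_term q n.+1 r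
  - (1 + q ^+ (2 * n + 1)) * bailey_term q n r
  = bailey_cert q n r.+1 - bailey_cert q n r.
Proof.
move=> hq; rewrite /bailey_term /bailey_cert.
set y := q ^+ (2 * r); set w := q ^+ (2 * r * r.-1).
have e1 : q ^+ (2 * r ^ 2) = w * y.
  by rewrite -exprD; congr (_ ^+ _); case: r {y w} => //= r; lia.
have e2 : q ^+ (2 * r.+1 * r.+1.-1) = w * y ^+ 2.
  by rewrite -exprM -exprD; congr (_ ^+ _); case: r {y w e1} => //= r; lia.
have e3 : q ^+ (4 * r) = y ^+ 2 by rewrite -exprM; congr (_ ^+ _); lia.
have e4 : q ^+ (4 * r.+1) = q ^+ 4 * y ^+ 2 by rewrite -e3 -exprD; congr (_ ^+ _); lia.
rewrite e1 e2 (_ : n.+1 + 2 * r + 2 = (n + 2 * r).+3)%N; last by lia.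
rewrite (_ : n + 2 * r.+1 + 1 = (n + 2 * r).+3)%N; last by lia.
rewrite (_ : n + 2 * r + 2 = (n + 2 * r).+2)%N; last by lia.
rewrite (_ : n + 2 * r + 1 = (n + 2 * r).+1)%N; last by lia.
rewrite (_ : 2 * r.+1 = (2 * r).+2)%N; last by lia.
have n1 := qq_neq0 K q (n + 2 * r).+1 hq.
have n2 := hq (n + 2 * r).+1; have n3 := hq (n + 2 * r).+2.
rewrite (qpochS _ q q (n + 2 * r).+2) (qpochS _ q q (n + 2 * r).+1) -!exprS.
have f1 : q ^+ (2 * n + 2) = q ^+ 2 * (q ^+ n) ^+ 2.
  by rewrite -exprM -exprD; congr (_ ^+ _); lia.
have f2 : q ^+ (2 * n + 3) = q ^+ 3 * (q ^+ n) ^+ 2.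
  by rewrite -exprM -exprD; congr (_ ^+ _); lia.
have f3 : q ^+ (2 * n + 1) = q * (q ^+ n) ^+ 2.
  by rewrite -exprM -exprS; congr (_ ^+ _); lia.
have f4 : q ^+ (4 * r + 2) = q ^+ 2 * y ^+ 2.
  by rewrite -exprM -exprD; congr (_ ^+ _); lia.
have f5 : q ^+ (n + 2 * r).+2 = q ^+ 2 * q ^+ n * y.
  by rewrite -!exprD; congr (_ ^+ _); lia.
have f6 : q ^+ (n + 2 * r).+3 = q ^+ 3 * q ^+ n * y.
  by rewrite -!exprD; congr (_ ^+ _); lia.
move: n2 n3; rewrite f1 f2 f3 f4 f5 f6 e3 e4 (exprS q n) (exprS (-1)) => n2 n3.
have -> : invqq q n (2 * r) = invqq q n.+1 (2 * r).+1 by [].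
rewrite !invqqSr //.
(* From here on the only reciprocal of a falling index is 1/(q)_(n+1-2r). *)
have [lt|] := ltnP n.+1 (2 * r).
  by rewrite /invqq leqNgt lt /= !(mulr0, mul0r) subr0.
rewrite subSS leq_eqVlt => /orP[/eqP e|le].
  rewrite e in n1 *; rewrite subnn (_ : (n - n.+1 = 0)%N); last by lia.
  rewrite ?expr0 ?subrr ?mul0r ?mulr0 ?mul0r.
  move: n2 n3; have -> : y = q * q ^+ n by rewrite /y e exprS.
  move=> n2 n3.
  by field; rewrite n1 n2 n3.
have -> : (n.+1 - 2 * r = (n - 2 * r).+1)%N by lia.
move: n2 n3; have -> : q ^+ n = y * q ^+ (n - 2 * r) by rewrite -exprD subnKC.
rewrite (exprS q (n - _)) => n2 n3.
by field; rewrite n1 n2 n3.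
Qed.

(** Summing the telescoping relation over r leaves nothing: the companion
vanishes at r = 0 and, being a multiple of 1/(q)_(n+1-2r), at 2r > n+1. *)
Lemma bailey_pair (K : fieldType) (q : K) (n s : nat) :
  (forall j, 1 - q ^+ j.+1 != 0) -> (n <= 2 * s)%N ->
  \sum_(r < s.+1) bailey_term q n r
  = qpoch (- q) (q ^+ 2) n / qpoch q q (2 * n + 1).
Proof.
move=> hq; elim: n s => [|n IH] s ns.
  rewrite big_ord_recl big1 => [|i _]; last first.
    by rewrite /bailey_term /invqq /= mulr0 mul0r.
  rewrite /bailey_term /invqq /= !qpochS !qpoch0 addr0.
  have n0 : 1 - q != 0 := hq 0%N; have n1 : 1 - q ^+ 2 != 0 := hq 1%N.
  rewrite !expr0 !mulr1 !mul1r; move: n1; rewrite expr2 => n1; rewrite expr1.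
  by field; rewrite n0 n1 oner_neq0.
have h2 := hq (2 * n).+1; have h3 := hq (2 * n).+2.
have S0 : \sum_(r < s.+1) (bailey_cert q n r.+1 - bailey_cert q n r) = 0.
  rewrite -(big_mkord xpredT (fun r => bailey_cert q n r.+1 - bailey_cert q n r)).
  rewrite telescope_sumr // /bailey_cert /invqq.
  rewrite [(2 * s.+1 <= _)%N]leqNgt (_ : n.+1 < 2 * s.+1)%N; last by lia.
  by rewrite /= !(muln0, expr0, subrr, mulr0, mul0r).
have := S0.
under eq_bigr => r _ do rewrite -bailey_term_telescope //.
rewrite sumrB -!mulr_sumr IH; last by lia.
move/eqP; rewrite subr_eq0 => /eqP E.
rewrite (_ : 2 * n.+1 + 1 = (2 * n).+3)%N; last by lia.
rewrite qpochS (qpochS _ q q (2 * n).+2) (qpochS _ q q (2 * n).+1) -!exprS.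
rewrite !addnS !addn0 in E.
have n1 := qq_neq0 K q (2 * n).+1 hq.
apply: (mulfI (mulf_neq0 h2 h3)); rewrite E.
have -> : - q * q ^+ 2 ^+ n = - q ^+ (2 * n).+1 by rewrite -exprM mulNr -exprS.
by field; rewrite n1 h2 h3.
Qed.

Lemma bin2D (m k : nat) : 'C(m + k, 2) = ('C(m, 2) + 'C(k, 2) + m * k)%N.
Proof.
elim: k => [|k IH]; first by rewrite muln0 !addn0.
by rewrite addnS !binS !bin1 IH; lia.
Qed.

Lemma half_mul_add3 (n : nat) : ((n * (n + 3))./2 = 'C(n, 2) + 2 * n)%N.
Proof.
rewrite bin2; have -> : (n * (n + 3) = n * n.-1 + (2 * n).*2)%N.
  by case: n => //= n; rewrite -mul2n; nia.
by rewrite halfD odd_double doubleK andbF.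
Qed.

(** After the shift n = m + k this is [qVandermonde] with a = q^(m+1) and
b = q^(m+2), since (n(n+3))/2 = (m(m+3))/2 + C(k,2) + k(m+2). *)
Lemma conjugate_bailey_pair (K : fieldType) (q : K) (m s : nat) :
  (forall j, 1 - q ^+ j.+1 != 0) ->
  \sum_(n < (m + s).+1) (-1) ^+ n * q ^+ (n * (n + 3))./2 * qpoch q q n
     * (qpoch q q (m + s) / qpoch q q (m + s - n))
     * invqq q n m / qpoch q q (n + m + 2)
  = (-1) ^+ m * q ^+ (m * (m + 3))./2 / (1 - q ^+ m.+1)
    * (qpoch q q (m + s) * qpoch q q (m + s).+1
       / (qpoch q q s * qpoch q q (m + s + m + 2))).
Proof.
move=> hq; have D := qq_neq0 K q ^~ hq.
have Dab j : 1 - q ^+ m.+1 * q ^+ m.+2 * q ^+ j != 0.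
  by rewrite -!exprD addSn addSn hq.
rewrite -addnS big_split_ord /= big1 ?add0r => [|i _]; last first.
  by rewrite /invqq leqNgt ltn_ord /= mulr0 mul0r.
have V := qVandermonde K q (q ^+ m.+1) (q ^+ m.+2) s Dab.
have -> : qpoch q q (m + s.+1) = qpoch q q m.+1 * qpoch (q ^+ m.+2) q s.
  by rewrite addnS -addSn qpochD -exprS.
have -> : qpoch q q (m + s + m + 2)
  = qpoch q q (m + m + 2) * qpoch (q ^+ m.+1 * q ^+ m.+2) q s.
  rewrite (_ : m + s + m + 2 = m + m + 2 + s)%N; last by lia.
  by rewrite qpochD -exprS -exprD; congr (_ * qpoch _ q s); congr (_ ^+ _); lia.
have n1 := qpoch_neq0 K _ q s Dab.
have n2 := hq m.
transitivity ((-1) ^+ m * q ^+ (m * (m + 3))./2 / (1 - q ^+ m.+1) * qpoch q q m.+1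
    * qpoch q q (m + s) / qpoch q q s / qpoch q q (m + m + 2)
    * (qpoch (q ^+ m.+2) q s / qpoch (q ^+ m.+1 * q ^+ m.+2) q s)); last first.
  by field; rewrite n1 n2 !D.
rewrite -V mulr_sumr; apply: eq_bigr => k _.
have ks : (k <= s)%N by rewrite -ltnS.
rewrite /invqq leq_addr addKn subnDl.
have -> : qpoch q q (m + k + m + 2)
  = qpoch q q (m + m + 2) * qpoch (q ^+ m.+1 * q ^+ m.+2) q k.
  rewrite (_ : m + k + m + 2 = m + m + 2 + k)%N; last by lia.
  by rewrite qpochD -exprS -exprD; congr (_ * qpoch _ q k); congr (_ ^+ _); lia.
have -> : qpoch q q (m + k) = qpoch q q m * qpoch (q ^+ m.+1) q k.
  by rewrite qpochD -exprS.
have B := qbin_qpoch K q (s - k) k; rewrite subnK // in B.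
rewrite -B qpochS -exprS.
rewrite (_ : q ^+ ((m + k) * (m + k + 3))./2 =
   q ^+ (m * (m + 3))./2 * q ^+ 'C(k, 2) * q ^+ m.+2 ^+ k); last first.
  rewrite -exprM -!exprD; congr (_ ^+ _); rewrite !half_mul_add3.
  rewrite bin2D; lia.
rewrite exprD.
(* The Gaussian binomial has to be cancelled, hence must not vanish. *)
have n3 := qpoch_neq0 K _ q k Dab.
have Nb : qbin q s k != 0.
  by apply/eqP => b0; move: B; rewrite b0 !mul0r => /eqP; rewrite eq_sym (negPf (D s)).
by field; rewrite n3 n2 Nb !D.
Qed.

Definition qhyp_term (K : fieldType) (q : K) (n : nat) : K :=
  (-1) ^+ n * q ^+ (n * (n + 3))./2 * qpoch q q n * qpoch (- q) (q ^+ 2) n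
  / qpoch q q (2 * n + 1).
Arguments qhyp_term {K} q n.

Definition theta_term (K : fieldType) (q : K) (r : nat) : K :=
  (-1) ^+ r * q ^+ (4 * r ^ 2 + 3 * r) * (1 + q ^+ (2 * r + 1)).
Arguments theta_term {K} q r.

(** The Bailey transform, with weights that make both sums finite. The
truncation order is even because the sum over r runs over 2r <= 2s. *)
Lemma truncated_identity (K : fieldType) (q : K) (s : nat) :
  (forall j, 1 - q ^+ j.+1 != 0) ->
  \sum_(n < (2 * s).+1)
     qhyp_term q n * (qpoch q q (2 * s) / qpoch q q (2 * s - n))
  = \sum_(r < s.+1) theta_term q r
     * (qpoch q q (2 * s) * qpoch q q (2 * s).+1
        / (qpoch q q (2 * s - 2 * r) * qpoch q q (2 * s + 2 * r + 2))).
Proof.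
move=> hq; have D := qq_neq0 K q ^~ hq.
(* Insert the Bailey pair in every term on the left. *)
transitivity (\sum_(n < (2 * s).+1) \sum_(r < s.+1)
  (-1) ^+ r * q ^+ (2 * r ^ 2) * (1 - q ^+ (4 * r + 2))
  * ((-1) ^+ n * q ^+ (n * (n + 3))./2 * qpoch q q n
     * (qpoch q q (2 * s) / qpoch q q (2 * s - n))
     * invqq q n (2 * r) / qpoch q q (n + 2 * r + 2))).
  apply: eq_bigr => n _; rewrite /qhyp_term.
  rewrite -[_ * _ / qpoch q q (2 * n + 1)]mulrA -(bailey_pair K q n s) //; last by rewrite -ltnS.
  rewrite mulr_sumr mulr_suml; apply: eq_bigr => r _.
  by rewrite /bailey_term; ring.
rewrite exchange_big /=; apply: eq_bigr => r _.
rewrite -mulr_sumr.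
have rs : (2 * r <= 2 * s)%N by rewrite leq_mul2l -ltnS ltn_ord.
have C := conjugate_bailey_pair K q (2 * r) (2 * s - 2 * r) hq.
rewrite subnKC // in C; rewrite C /theta_term.
rewrite [(-1) ^+ (2 * r)]exprM sqrrN expr1n expr1n.
have -> : q ^+ (4 * r ^ 2 + 3 * r) = q ^+ (2 * r ^ 2) * q ^+ (2 * r * (2 * r + 3))./2.
  have -> : ((2 * r * (2 * r + 3))./2 = r * (2 * r + 3))%N.
    by rewrite -mulnA mul2n doubleK.
  by rewrite -exprD; congr (_ ^+ _); nia.
have -> : q ^+ (4 * r + 2) = q ^+ (2 * r).+1 ^+ 2.
  by rewrite -exprM; congr (_ ^+ _); lia.
rewrite addn1; have n1 := hq (2 * r)%N.
by field; rewrite n1 !D.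
Qed.

(** * Absolute convergence of complex series *)

(** The norm of a complex number is itself an element of the complex field; this
is the same norm with values in R, where completeness and the exponential
function are available. *)
Definition cnorm (R : realType) (z : Cplx R) : R := complex.Re `|z|.
Arguments cnorm {R} z.

Lemma cnormE (R : realType) (z : Cplx R) : `|z| = (cnorm z)%:C%C.
Proof. by rewrite /cnorm normc_def. Qed.

Lemma cnorm_ge0 (R : realType) (z : Cplx R) : 0 <= cnorm z.
Proof. by rewrite -lecR -cnormE normr_ge0. Qed.

Lemma cnorm0 (R : realType) : cnorm (0 : Cplx R) = 0.
Proof. by apply: complexI; rewrite -cnormE normr0. Qed.

Lemma cnorm1 (R : realType) : cnorm (1 : Cplx R) = 1.
Proof. by apply: complexI; rewrite -cnormE normr1. Qed.

Lemma cnormN (R : realType) (z : Cplx R) : cnorm (- z) = cnorm z.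
Proof. by apply: complexI; rewrite -!cnormE normrN. Qed.

Lemma cnormM (R : realType) (z w : Cplx R) : cnorm (z * w) = cnorm z * cnorm w.
Proof. by apply: complexI; rewrite rmorphM /= -!cnormE normrM. Qed.

Lemma cnormV (R : realType) (z : Cplx R) : cnorm z^-1 = (cnorm z)^-1.
Proof. by apply: complexI; rewrite fmorphV /= -!cnormE normfV. Qed.

Lemma cnormX (R : realType) (z : Cplx R) (n : nat) : cnorm (z ^+ n) = cnorm z ^+ n.
Proof. by apply: complexI; rewrite rmorphXn /= -!cnormE normrX. Qed.

Lemma cnormD (R : realType) (z w : Cplx R) : cnorm (z + w) <= cnorm z + cnorm w.
Proof. by rewrite -lecR rmorphD /= -!cnormE ler_normD. Qed.

Lemma cnormB (R : realType) (z w : Cplx R) : cnorm (z - w) <= cnorm z + cnorm w.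
Proof. by rewrite -(cnormN _ w) cnormD. Qed.

Lemma cnorm_sum (R : realType) (n : nat) (F : nat -> Cplx R) :
  cnorm (\sum_(i < n) F i) <= \sum_(i < n) cnorm (F i).
Proof.
elim: n => [|n IH]; first by rewrite !big_ord0 cnorm0.
by rewrite !big_ord_recr /= (le_trans (cnormD _ _ _)) // lerD2r.
Qed.

Lemma cnorm_le_ReIm (R : realType) (z : Cplx R) :
  cnorm z <= `|complex.Re z| + `|complex.Im z|.
Proof.
case: z => a b; rewrite /cnorm normc_def /=.
rewrite -[leRHS]ger0_norm ?addr_ge0 // -sqrtr_sqr ler_wsqrtr //.
rewrite sqrrD !real_normK ?num_real // -subr_ge0.
rewrite (_ : _ - _ = `|a| * `|b| *+ 2); last by ring.
by rewrite mulrn_wge0 // mulr_ge0.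
Qed.

Lemma Re_le_cnorm (R : realType) (z : Cplx R) : `|complex.Re z| <= cnorm z.
Proof.
case: z => a b; rewrite /cnorm normc_def /=.
by rewrite -sqrtr_sqr ler_wsqrtr // lerDl sqr_ge0.
Qed.

Lemma Im_le_cnorm (R : realType) (z : Cplx R) : `|complex.Im z| <= cnorm z.
Proof.
case: z => a b; rewrite /cnorm normc_def /=.
by rewrite -sqrtr_sqr ler_wsqrtr // lerDr sqr_ge0.
Qed.

Lemma cvg_cnorm (R : realType) (u : nat -> Cplx R) (l : Cplx R) :
  cnorm (u n - l) @[n --> \oo] --> (0 : R) -> u @ \oo --> l.
Proof.
move=> h; apply/cvgrPdist_lt => e e0.
have [r0 er] : 0 < complex.Re e /\ e = (complex.Re e)%:C%C.
  by case: e e0 => a b; rewrite ltcE /= => /andP[/eqP -> a0].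
near=> n; rewrite distrC cnormE er ltcR.
near: n; exact: (cvgr_lt _ h _ r0).
Unshelve. all: by end_near. Qed.

(** Comparison test: the real and imaginary parts are absolutely convergent
real series. *)
Lemma cvg_series_dom (R : realType) (u : nat -> Cplx R) (v : nat -> R) :
  (forall n, cnorm (u n) <= v n) -> cvgn (series v) -> cvgn (series u).
Proof.
move=> uv cv.
have key (f : Cplx R -> R) : (forall z, `|f z| <= cnorm z) ->
    cvgn (series (f \o u)).
  move=> fz; apply: normed_cvg; apply: series_le_cvg cv => n //=.
    exact: le_trans (cnorm_ge0 _ _) (uv n).
  exact: le_trans (fz _) (uv n).
have /cvg_ex[a ca] := key (@complex.Re R) (@Re_le_cnorm R).
have /cvg_ex[b cb] := key (@complex.Im R) (@Im_le_cnorm R).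
apply/cvg_ex; exists ((a +i* b)%C : Cplx R); apply: cvg_cnorm.
have E n : complex.Re (series u n) = series (@complex.Re R \o u) n /\
           complex.Im (series u n) = series (@complex.Im R \o u) n.
  elim: n => [|n [IH1 IH2]]; first by rewrite /series /= !big_nil.
  move: IH1 IH2; rewrite /series /= !big_nat_recr //=.
  move=> <- <-; split; [exact: raddfD|exact: raddfD].
apply: (@squeeze_cvgr _ _ _ _ (cst 0)
   (fun n => `|series (@complex.Re R \o u) n - a| + `|series (@complex.Im R \o u) n - b|)).
- near=> n; rewrite cnorm_ge0 /=; apply: le_trans (cnorm_le_ReIm _ _) _.
  have [<- <-] := E n; by case: (series u n).
- exact: cvg_cst.
- have -> : 0 = `|a - a| + `|b - b| :> R by rewrite !subrr !normr0 addr0.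
  by apply: cvgD; apply: cvg_norm; apply: cvgB => //; exact: cvg_cst.
Unshelve. all: by end_near. Qed.

(** * Bounds uniform in the length of the products *)

Lemma geometric_sum_le (R : realType) (x : R) (n : nat) :
  0 <= x -> x < 1 -> \sum_(i < n) x ^+ i <= (1 - x)^-1.
Proof.
move=> x0 x1; have c0 : 0 < 1 - x by rewrite subr_gt0.
rewrite -div1r ler_pdivlMr //.
have -> : (\sum_(i < n) x ^+ i) * (1 - x) = 1 - x ^+ n.
  elim: n => [|n IH]; first by rewrite big_ord0 mul0r expr0 subrr.
  by rewrite big_ord_recr /= mulrDl IH exprS; ring.
by rewrite gerBl exprn_ge0.
Qed.

(** One constant serves for all lengths, all arguments and all bases in the disc
of radius x < 1. With y = |a p^k| <= x^(k+1), both 1 + y and 1/(1-y) are at most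
exp(y/(1-x)), and y/(1-x) is at most (x^k - x^(k+1)) / (1-x)^2; the product of
these bounds telescopes to at most exp(1/(1-x)^2). The third bound follows by
adding up the differences of consecutive products. *)
Lemma qpoch_bound (R : realType) (x : R) : 0 <= x -> x < 1 ->
  exists2 C : R, 1 <= C & forall (a p : Cplx R) (n : nat),
    cnorm a <= x -> cnorm p <= x ->
    [/\ cnorm (qpoch a p n) <= C, cnorm (qpoch a p n)^-1 <= C
      & cnorm (qpoch a p n - 1) <= C * cnorm a].
Proof.
move=> x0 x1; set c : R := (1 - x)^-1.
have c0 : 0 < 1 - x by rewrite subr_gt0.
have c1 : 1 <= c by rewrite /c invf_ge1 // gerBl.
have cx : c * (1 - x) = 1 by rewrite mulVf // gt_eqF.
pose E : R := expR (c ^+ 2).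
have E1 : 1 <= E by rewrite -expR0 ler_expR sqr_ge0.
exists (E * c) => [|a p n ax px]; first by rewrite mulr_ege1.
have xn k : 0 <= x ^+ k by rewrite exprn_ge0.
have yb k : cnorm (a * p ^+ k) <= cnorm a * x ^+ k.
  by rewrite cnormM cnormX ler_wpM2l ?cnorm_ge0 // lerXn2r // nnegrE cnorm_ge0.
have yx k : cnorm (a * p ^+ k) <= x ^+ k * x.
  by rewrite (le_trans (yb k)) // mulrC ler_wpM2l.
have yx1 k : cnorm (a * p ^+ k) <= x.
  by rewrite (le_trans (yx k)) // ler_piMl // exprn_ile1 // ltW.
have ye k : cnorm (a * p ^+ k) * c <= (x ^+ k - x ^+ k.+1) * c ^+ 2.
  rewrite exprS (_ : (_ - _) * _ = x ^+ k * (c * (1 - x)) * c); last by ring.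
  rewrite cx mulr1 ler_wpM2r ?(le_trans _ c1) //.
  by rewrite (le_trans (yx k)) // ler_piMr // ltW.
have up k : cnorm (1 - a * p ^+ k) <= expR ((x ^+ k - x ^+ k.+1) * c ^+ 2).
  apply: le_trans (_ : 1 + cnorm (a * p ^+ k) <= _).
    by rewrite (le_trans (cnormB _ _ _)) // cnorm1.
  apply: le_trans (expR_ge1Dx _) _; rewrite ler_expR (le_trans _ (ye k)) //.
  by rewrite ler_peMr ?cnorm_ge0.
have lo k : 1 - x <= cnorm (1 - a * p ^+ k) /\
  cnorm (1 - a * p ^+ k)^-1 <= expR ((x ^+ k - x ^+ k.+1) * c ^+ 2).
  set y := cnorm (a * p ^+ k).
  have l1 : 1 - y <= cnorm (1 - a * p ^+ k).
    have := cnormD _ (1 - a * p ^+ k) (a * p ^+ k).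
    by rewrite subrK cnorm1 -/y; lra.
  have yx' : y <= x := yx1 k.
  split; first by apply: le_trans l1; lra.
  have y0 : 0 < 1 - y by lra.
  rewrite cnormV; apply: le_trans (_ : (1 - y)^-1 <= _).
    by rewrite lef_pV2 // posrE // (lt_le_trans y0).
  have -> : (1 - y)^-1 = 1 + y / (1 - y) by field; rewrite gt_eqF.
  apply: le_trans (expR_ge1Dx _) _; rewrite ler_expR (le_trans _ (ye k)) //.
  rewrite ler_wpM2l ?cnorm_ge0 // lef_pV2 ?posrE //; lra.
have B1 k : cnorm (qpoch a p k) <= expR ((1 - x ^+ k) * c ^+ 2).
  elim: k => [|k IH]; first by rewrite qpoch0 cnorm1 expr0 subrr mul0r expR0.
  rewrite qpochS cnormM.
  rewrite (_ : (1 - x ^+ k.+1) * c ^+ 2 =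
    (1 - x ^+ k) * c ^+ 2 + (x ^+ k - x ^+ k.+1) * c ^+ 2); last by ring.
  by rewrite expRD ler_pM ?cnorm_ge0.
have B2 k : cnorm (qpoch a p k)^-1 <= expR ((1 - x ^+ k) * c ^+ 2).
  elim: k => [|k IH]; first by rewrite qpoch0 invr1 cnorm1 expr0 subrr mul0r expR0.
  rewrite qpochS invfM cnormM.
  rewrite (_ : (1 - x ^+ k.+1) * c ^+ 2 =
    (1 - x ^+ k) * c ^+ 2 + (x ^+ k - x ^+ k.+1) * c ^+ 2); last by ring.
  by rewrite expRD ler_pM ?cnorm_ge0 //; case: (lo k).
have BE k : expR ((1 - x ^+ k) * c ^+ 2) <= E.
  by rewrite ler_expR ler_piMl ?sqr_ge0 // gerBl.
have Ec : E <= E * c by rewrite ler_peMr // (le_trans _ E1).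
split; [exact: le_trans (le_trans (B1 n) (BE n)) Ec|
        exact: le_trans (le_trans (B2 n) (BE n)) Ec|].
have B3 k : cnorm (qpoch a p k - 1) <= E * cnorm a * ((1 - x ^+ k) * c).
  elim: k => [|k IH]; first by rewrite qpoch0 subrr cnorm0 expr0 subrr mul0r mulr0.
  rewrite qpochS (_ : _ - 1 = (qpoch a p k - 1) - qpoch a p k * (a * p ^+ k)); last by ring.
  apply: le_trans (cnormB _ _ _) _.
  rewrite (_ : (1 - x ^+ k.+1) * c = (1 - x ^+ k) * c + x ^+ k * (c * (1 - x))); last by rewrite exprS; ring.
  rewrite cx mulr1 [leRHS]mulrDr lerD // cnormM -mulrA ler_pM ?cnorm_ge0 //.
  exact: le_trans (B1 k) (BE k).
apply: le_trans (B3 n) _; rewrite mulrAC ler_wpM2r ?cnorm_ge0 //.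
rewrite ler_wpM2l ?(le_trans _ E1) // ler_piMl ?(le_trans _ c1) // gerBl //.
Qed.

Lemma cvg_series_geo (R : realType) (u : nat -> Cplx R) (C x : R) :
  0 <= x -> x < 1 -> (forall n, cnorm (u n) <= C * x ^+ n) -> cvgn (series u).
Proof.
move=> x0 x1 h; apply: (cvg_series_dom R u (geometric C x)) => //.
by apply: is_cvg_geometric_series; rewrite ger0_norm.
Qed.

Lemma one_sub_neq0 (R : realType) (q : Cplx R) : cnorm q < 1 ->
  forall j, 1 - q ^+ j.+1 != 0.
Proof.
move=> x1 j; rewrite subr_eq0; apply/eqP => e.
have := cnorm1 R; rewrite e cnormX => /eqP; rewrite lt_eqF //.
by rewrite exprn_ilt1 // cnorm_ge0.
Qed.

Lemma qhyp_term_bound (R : realType) (q : Cplx R) : cnorm q < 1 ->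
  exists2 C : R, 0 <= C & forall n, cnorm (qhyp_term q n) <= C * cnorm q ^+ (2 * n).
Proof.
move=> x1; have x0 := cnorm_ge0 R q.
have [C C1 B] := qpoch_bound R (cnorm q) x0 x1.
exists (C * C * C) => [|n]; first by rewrite !mulr_ge0 // (le_trans _ C1).
have [b1 _ _] := B q q n (lexx _) (lexx _).
have [_ b2 _] := B q q (2 * n + 1)%N (lexx _) (lexx _).
have [||b3 _ _] := B (- q) (q ^+ 2) n; first by rewrite cnormN.
  by rewrite cnormX ler_iXnr // ltW.
rewrite /qhyp_term !cnormM !cnormX cnormN cnorm1 expr1n mul1r.
rewrite (_ : C * C * C * _ = cnorm q ^+ (2 * n) * C * C * C); last by ring.
rewrite !ler_pM ?mulr_ge0 ?exprn_ge0 ?cnorm_ge0 //.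
by rewrite ler_wiXn2l // ?ltW // half_mul_add3 leq_addl.
Qed.

Lemma theta_term_bound (R : realType) (q : Cplx R) (r : nat) : cnorm q < 1 ->
  cnorm (theta_term q r) <= 2 * cnorm q ^+ (3 * r).
Proof.
move=> x1; have x0 := cnorm_ge0 R q.
rewrite /theta_term !cnormM !cnormX cnormN cnorm1 expr1n mul1r mulrC.
rewrite ler_pM ?exprn_ge0 ?cnorm_ge0 //.
  apply: le_trans (cnormD _ _ _) _; rewrite cnorm1 cnormX (_ : 2 = 1 + 1) //.
  by rewrite lerD2l exprn_ile1 // ltW.
by rewrite ler_wiXn2l // ?ltW // leq_addl.
Qed.

(** The weight (q)_N/(q)_(N-n) equals (q^(N-n+1);q)_n, which is 1 + O(x^(N-n));
multiplied by a term of size O(x^(2n)) the error is O(x^N x^n), and the factor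
x^n makes the sum over n bounded. *)
Lemma qhyp_weight_bound (R : realType) (q : Cplx R) : cnorm q < 1 ->
  exists2 C : R, 0 <= C & forall N,
   cnorm (\sum_(n < N.+1) qhyp_term q n
     - \sum_(n < N.+1) qhyp_term q n * (qpoch q q N / qpoch q q (N - n)))
   <= C * cnorm q ^+ N.
Proof.
move=> x1; have x0 := cnorm_ge0 R q.
have hq := one_sub_neq0 R q x1.
have [C C1 B] := qpoch_bound R (cnorm q) x0 x1.
have [T T0 BT] := qhyp_term_bound R q x1.
have C0 : 0 <= C := le_trans ler01 C1.
have i0 : 0 <= (1 - cnorm q)^-1 by rewrite invr_ge0 subr_ge0 ltW.
exists (T * C * (1 - cnorm q)^-1) => [|N]; first by rewrite !mulr_ge0.
rewrite -sumrB.
rewrite (eq_bigr (fun n : 'I_N.+1 => - (qhyp_term q n * (qpoch (q ^+ (N - n).+1) q n - 1)))); last first.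
  move=> n _; have nN : (n <= N)%N by rewrite -ltnS.
  have -> : qpoch q q N = qpoch q q (N - n) * qpoch (q ^+ (N - n).+1) q n.
    by rewrite -{1}(subnK nN) qpochD -exprS.
  by field; rewrite qq_neq0.
apply: le_trans (cnorm_sum R N.+1 (fun n => - (qhyp_term q n * (qpoch (q ^+ (N - n).+1) q n - 1)))) _.
apply: le_trans (_ : \sum_(n < N.+1) T * C * cnorm q ^+ N * cnorm q ^+ n <= _).
  apply: ler_sum => n _; have nN : (n <= N)%N by rewrite -ltnS.
  rewrite cnormN cnormM.
  have [||_ _ b] := B (q ^+ (N - n).+1) q n => //.
    by rewrite cnormX ler_iXnr // ltW.
  apply: le_trans (ler_pM _ _ (BT n) b) _; rewrite ?cnorm_ge0 // cnormX.
  rewrite mulrACA -[leRHS]mulrA ler_wpM2l ?mulr_ge0 // -!exprD.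
  by rewrite ler_wiXn2l // ?ltW //; lia.
rewrite -mulr_sumr -[leLHS]mulrA -[leRHS]mulrA ler_wpM2l ?mulr_ge0 //.
rewrite [leLHS]mulrC ler_wpM2r ?exprn_ge0 //.
exact: geometric_sum_le.
Qed.

(** Here the weight is the quotient of (q^(N-2r+1);q)_(2r) by
(q^(N+2);q)_(2r+1), with N = 2s, so it is 1 + O(x^(N-2r)); the terms are
O(x^(3r)). *)
Lemma theta_weight_bound (R : realType) (q : Cplx R) : cnorm q < 1 ->
  exists2 C : R, 0 <= C & forall s,
   cnorm (\sum_(r < s.+1) theta_term q r
     - \sum_(r < s.+1) theta_term q r
     * (qpoch q q (2 * s) * qpoch q q (2 * s).+1
        / (qpoch q q (2 * s - 2 * r) * qpoch q q (2 * s + 2 * r + 2))))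
   <= C * cnorm q ^+ (2 * s).
Proof.
move=> x1; have x0 := cnorm_ge0 R q.
have hq := one_sub_neq0 R q x1.
have [C C1 B] := qpoch_bound R (cnorm q) x0 x1.
have C0 : 0 <= C := le_trans ler01 C1.
have i0 : 0 <= (1 - cnorm q)^-1 by rewrite invr_ge0 subr_ge0 ltW.
exists (2 * (2 * C * C) * (1 - cnorm q)^-1) => [|s]; first by rewrite !mulr_ge0.
rewrite -sumrB; set N := (2 * s)%N.
pose A r := qpoch (q ^+ (N - 2 * r).+1) q (2 * r).
pose D r := qpoch (q ^+ N.+2) q (2 * r + 1).
rewrite (eq_bigr (fun r : 'I_s.+1 => - (theta_term q r * (((A r - 1) - (D r - 1)) * (D r)^-1)))); last first.
  move=> r _; have rN : (2 * r <= N)%N by rewrite leq_mul2l -ltnS ltn_ord.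
  have -> : qpoch q q N = qpoch q q (N - 2 * r) * A r.
    by rewrite -{1}(subnK rN) qpochD -exprS.
  have -> : qpoch q q (N + 2 * r + 2) = qpoch q q N.+1 * D r.
    rewrite (_ : N + 2 * r + 2 = N.+1 + (2 * r + 1))%N; last by lia.
    by rewrite qpochD -exprS.
  have d0 : D r != 0.
    by apply: qpoch_neq0 => j; rewrite -exprD addSn hq.
  by field; rewrite d0 !qq_neq0.
apply: le_trans (cnorm_sum R s.+1 (fun r => - (theta_term q r * (((A r - 1) - (D r - 1)) * (D r)^-1)))) _.
apply: le_trans (_ : \sum_(r < s.+1) 2 * (2 * C * C) * cnorm q ^+ N * cnorm q ^+ r <= _).
  apply: ler_sum => r _; have rN : (2 * r <= N)%N by rewrite leq_mul2l -ltnS ltn_ord.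
  rewrite cnormN cnormM.
  have [||_ _ b1] := B (q ^+ (N - 2 * r).+1) q (2 * r)%N => //.
    by rewrite cnormX ler_iXnr // ltW.
  have [||_ b2 b3] := B (q ^+ N.+2) q (2 * r + 1)%N => //.
    by rewrite cnormX ler_iXnr // ltW.
  have b4 : cnorm ((A r - 1) - (D r - 1)) <= 2 * C * cnorm q ^+ (N - 2 * r).
    apply: le_trans (cnormB _ _ _) _.
    rewrite -mulrA mulr_natl mulr2n lerD //.
      apply: le_trans b1 _; rewrite cnormX ler_wpM2l //.
      by rewrite ler_wiXn2l // ?ltW.
    apply: le_trans b3 _; rewrite cnormX ler_wpM2l //.
    by rewrite ler_wiXn2l // ?ltW //; lia.
  have b5 : cnorm (((A r - 1) - (D r - 1)) * (D r)^-1) <= 2 * C * cnorm q ^+ (N - 2 * r) * C.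
    by rewrite cnormM ler_pM ?cnorm_ge0.
  apply: le_trans (ler_pM _ _ (theta_term_bound R q r x1) b5) _; rewrite ?cnorm_ge0 //.
  rewrite (_ : 2 * cnorm q ^+ (3 * r) * (2 * C * cnorm q ^+ (N - 2 * r) * C) =
    2 * (2 * C * C) * (cnorm q ^+ (3 * r) * cnorm q ^+ (N - 2 * r))); last by ring.
  rewrite -[leRHS]mulrA ler_wpM2l ?mulr_ge0 // -!exprD.
  by rewrite ler_wiXn2l // ?ltW //; lia.
rewrite -mulr_sumr -[leLHS]mulrA -[leRHS]mulrA ler_wpM2l ?mulr_ge0 //.
rewrite [leLHS]mulrC ler_wpM2r ?exprn_ge0 //.
exact: geometric_sum_le.
Qed.

(** * Passing to the limit *)

Lemma cvg_double : (fun s => 2 * s)%N @ \oo --> \oo.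
Proof.
apply/cvgnyPge => N; exists N => // s /= Ns.
by rewrite (leq_trans Ns) // leq_pmull.
Qed.

Lemma cvg_series_double (R : realType) (u : nat -> Cplx R) :
  cvgn (series u) -> series u (2 * s)%N @[s --> \oo] --> limn (series u).
Proof. by move=> cu; exact: (cvg_comp _ _ cvg_double cu). Qed.

Lemma cvg_seriesS (R : realType) (u : nat -> Cplx R) :
  cvgn (series u) -> series u n.+1 @[n --> \oo] --> limn (series u).
Proof. by move=> cu; rewrite (cvg_shiftS (series u)). Qed.

(** The partial sums of lengths 2s+1 and s+1 differ by O(x^(2s)), as both are
that close to the common value of the weighted sums. *)
Lemma lim_qhyp_theta (R : realType) (q : Cplx R) : cnorm q < 1 ->
  [/\ cvgn (series (qhyp_term q)), cvgn (series (theta_term q)) &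
      limn (series (qhyp_term q)) = limn (series (theta_term q))].
Proof.
move=> x1; have x0 := cnorm_ge0 R q.
have [T T0 BT] := qhyp_term_bound R q x1.
have cr : cvgn (series (qhyp_term q)).
  apply: (cvg_series_geo R _ T (cnorm q)) => // n; apply: le_trans (BT n) _.
  by rewrite ler_wpM2l // ler_wiXn2l // ?ltW // leq_pmull.
have ct : cvgn (series (theta_term q)).
  apply: (cvg_series_geo R _ 2 (cnorm q)) => // n.
  apply: le_trans (theta_term_bound R q n x1) _.
  by rewrite ler_wpM2l // ler_wiXn2l // ?ltW // leq_pmull.
split => //.
have [C C0 B] := qhyp_weight_bound R q x1.
have [D D0 B'] := theta_weight_bound R q x1.
have l1 : series (qhyp_term q) (2 * s).+1 @[s --> \oo] --> limn (series (qhyp_term q)).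
  exact: (cvg_comp _ _ cvg_double (cvg_seriesS _ _ cr)).
have l2 : series (theta_term q) s.+1 @[s --> \oo] --> limn (series (theta_term q)).
  exact: (cvg_seriesS _ _ ct).
have l3 : series (qhyp_term q) (2 * s).+1 - series (theta_term q) s.+1 @[s --> \oo] --> (0 : Cplx R).
  apply: cvg_cnorm; apply: (@squeeze_cvgr _ _ _ _ (cst 0) (geometric (C + D) (cnorm q ^+ 2))).
  - near=> s; rewrite cnorm_ge0 /= subr0 /series /= !big_mkord.
    set S := \sum_(n < _) _; set S' := \sum_(r < _) _.
    have I := truncated_identity _ q s (one_sub_neq0 R q x1).
    have b1 := B (2 * s)%N; have b2 := B' s; rewrite I -/S in b1.
    rewrite -/S' in b2; set X := (X in S - X) in b1.
    rewrite (_ : S - S' = (S - X) - (S' - X)); last by ring.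
    by rewrite -exprM mulrDl (le_trans (cnormB _ _ _)) // lerD.
  - exact: cvg_cst.
  - by apply: cvg_geometric; rewrite ger0_norm ?exprn_ge0 // exprn_ilt1.
apply/eqP; rewrite -subr_eq0; apply/eqP.
exact: (cvg_unique _ (cvgB l1 l2) l3).
Unshelve. all: by end_near. Qed.

Lemma half_tri (n : nat) : (2 * (n * n.+1)./2 = n * n.+1)%N.
Proof. by rewrite mul2n even_halfK // oddM /= andbN. Qed.

Lemma half_tri_pred (n : nat) : (2 * (n * n.-1)./2 = n * n.-1)%N.
Proof. by case: n => //= n; rewrite [(n.+1 * n)%N]mulnC half_tri. Qed.

(** In the second series the index is shifted to start at 0. *)
Lemma Psi_lim (R : realType) (a b : Cplx R) (f g : nat -> Cplx R) :
  (forall n, a ^+ (n * n.+1)./2 * b ^+ (n * n.-1)./2 = f n) ->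
  (forall n, a ^+ (n.+1 * n)./2 * b ^+ (n.+1 * n.+2)./2 = g n) ->
  cvgn (series g) -> Psi a b = limn (series f) - limn (series g).
Proof.
move=> hf hg cg; rewrite /Psi; congr (_ - _).
  by congr (limn _); apply/funext => N; apply: eq_bigr => n _.
apply/cvg_lim => //; rewrite -cvg_shiftS.
rewrite (_ : [sequence _]_n = series g) //; apply/funext => N /=.
by rewrite big_add1 /=; apply: eq_bigr => n _; rewrite -hg.
Qed.

Lemma cvg_series_expr (R : realType) (q : Cplx R) (e : nat -> nat) :
  cnorm q < 1 -> (forall n, n <= e n)%N -> cvgn (series (fun n => q ^+ e n)).
Proof.
move=> x1 he; apply: (cvg_series_geo R _ 1 (cnorm q)) => // [|n].
  exact: cnorm_ge0.
by rewrite mul1r cnormX ler_wiXn2l ?cnorm_ge0 // ltW.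
Qed.

(** An even index r = 2N of the theta series produces the exponents
16N^2 + 6N and 16N^2 + 10N + 1 with sign +, an odd index r = 2N+1 produces
16N^2 + 22N + 7 and 16N^2 + 26N + 10 with sign -. These are the four series of
the two false theta functions. *)
Lemma Psi_theta (R : realType) (q : Cplx R) : cnorm q < 1 ->
  cvgn (series (theta_term q)) ->
  Psi (q ^+ 22) (q ^+ 10) + q * Psi (q ^+ 26) (q ^+ 6)
  = limn (series (theta_term q)).
Proof.
move=> x1 ct.
pose a n := q ^+ (16 * n ^ 2 + 6 * n); pose b n := q ^+ (16 * n ^ 2 + 26 * n + 10).
pose c n := q ^+ (16 * n ^ 2 + 10 * n); pose d n := q ^+ (16 * n ^ 2 + 22 * n + 6).
have ca : cvgn (series a) by apply: cvg_series_expr => // n; lia.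
have cb : cvgn (series b) by apply: cvg_series_expr => // n; lia.
have cc : cvgn (series c) by apply: cvg_series_expr => // n; lia.
have cd : cvgn (series d) by apply: cvg_series_expr => // n; lia.
have e1 i j n : (q ^+ (2 * i)) ^+ (n * n.+1)./2 * (q ^+ (2 * j)) ^+ (n * n.-1)./2
   = q ^+ (i * (n * n.+1) + j * (n * n.-1)).
  rewrite -!exprM -exprD; congr (_ ^+ _).
  by rewrite (mulnAC 2 i) (mulnAC 2 j) half_tri half_tri_pred mulnC [(_ * j)%N]mulnC.
have e2 i j n : (q ^+ (2 * i)) ^+ (n.+1 * n)./2 * (q ^+ (2 * j)) ^+ (n.+1 * n.+2)./2
   = q ^+ (i * (n * n.+1) + j * (n.+1 * n.+2)).
  rewrite -!exprM -exprD; congr (_ ^+ _).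
  rewrite [(n.+1 * n)%N]mulnC (mulnAC 2 i) (mulnAC 2 j) !half_tri mulnC.
  by rewrite [(_ * j)%N]mulnC.
have ea n : (q ^+ 22) ^+ (n * n.+1)./2 * (q ^+ 10) ^+ (n * n.-1)./2 = a n.
  by rewrite (e1 11 5)%N; congr (_ ^+ _); case: n => [|n]; rewrite /=; lia.
have eb n : (q ^+ 22) ^+ (n.+1 * n)./2 * (q ^+ 10) ^+ (n.+1 * n.+2)./2 = b n.
  by rewrite (e2 11 5)%N; congr (_ ^+ _); lia.
have ec n : (q ^+ 26) ^+ (n * n.+1)./2 * (q ^+ 6) ^+ (n * n.-1)./2 = c n.
  by rewrite (e1 13 3)%N; congr (_ ^+ _); case: n => [|n]; rewrite /=; lia.
have ed n : (q ^+ 26) ^+ (n.+1 * n)./2 * (q ^+ 6) ^+ (n.+1 * n.+2)./2 = d n.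
  by rewrite (e2 13 3)%N; congr (_ ^+ _); lia.
rewrite (Psi_lim R _ _ a b ea eb cb) (Psi_lim R _ _ c d ec ed cd).
have S N : series a N - series b N + q * (series c N - series d N)
  = series (theta_term q) (2 * N)%N.
  elim: N => [|N IH]; first by rewrite /series /= !big_geq // !subrr mulr0 addr0.
  move: IH; rewrite (_ : 2 * N.+1 = (2 * N).+2)%N; last by lia.
  rewrite /series /= !big_nat_recr //= => <-.
  have t1 : theta_term q (2 * N) = a N + q * c N.
    rewrite /theta_term exprM sqrrN expr1n expr1n mul1r mulrDr mulr1 -exprD /a /c -exprS.
    by congr (_ ^+ _ + _ ^+ _); lia.
  have t2 : theta_term q (2 * N).+1 = - b N - q * d N.
    rewrite /theta_term exprS exprM sqrrN expr1n expr1n mulr1 !mulN1r mulrDr mulr1 mulNr -exprD /b /d -exprS.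
    rewrite addrC; congr (- _ ^+ _ - _ ^+ _); lia.
  by rewrite t1 t2; ring.
have L : series a N - series b N + q * (series c N - series d N) @[N --> \oo]
  --> limn (series a) - limn (series b) + q * (limn (series c) - limn (series d)).
  exact: (cvgD (cvgB ca cb) (cvgM (cvg_cst q) (cvgB cc cd))).
have L' := cvg_series_double R _ ct.
rewrite -(funext S) in L'; exact: (cvg_unique _ L L').
Qed.

Theorem mainTheorem13 (R : realType) (q : Cplx R) (hq : `|q| < 1) :
  let term (n : nat) : Cplx R :=
    (-1) ^+ n * q ^+ (n * (n + 3))./2 * qpoch q q n * qpoch (- q) (q ^+ 2) n
    / qpoch q q (2 * n + 1) in
  cvgn (series term) /\
  Psi (q ^+ 22) (q ^+ 10) + q * Psi (q ^+ 26) (q ^+ 6)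
    = \sum_(0 <= n <oo) term n.
Proof.
have x1 : cnorm q < 1 by rewrite -ltcR -cnormE.
have [cr ct E] := lim_qhyp_theta R q x1.
split; first exact: cr.
by rewrite Psi_theta // -E.
Qed.
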